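(* Let $(\Xi_n)_{n\ge 0}$ be a sequence of vectors in $\mathbb{R}^N$ and let $(K_{ij})_{i,j\ge 0}$ be a family of real $N\times N$ matrices. Let the vectors $X_n\in\mathbb{R}^N$, $n\ge 0$, be defined recursively by $$X_n=\Xi_n+\sum_{l=0}^{n-1}\sum_{i=0}^{n-l-1}\frac{1}{n-i}\,K_{i,n-i-l-1}\,X_l ,\qquad n\ge 0,$$ and let $$L_0:=0,\qquad L_n:=\sum_{i=0}^{n-1}\|K_{i,n-i-1}\|\quad (n\ge 1).$$ Suppose that there are constants $R>0$, $M_0$ and $M$ such that, for all $n\ge 0$, $$\|\Xi_n\|\le \frac{M_0}{R^n},\qquad L_n\le\frac{M}{R^n}.$$ Then the radius of convergence $R_X$ of the power series $\sum_{n=0}^{\infty}t^nX_n$ satisfies $$R_X\ge\frac{R}{1+RM}.$$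
   Context: $\|\cdot\|$ denotes a fixed vector norm on $\mathbb{R}^N$ and also the induced matrix norm on $N\times N$ matrices. Sums over empty index sets are $0$ (so $X_0=\Xi_0$). The radius of convergence may be $+\infty$. The recursion arises from substituting $x(t)=\sum t^iX_i$, $\xi(t)=\sum t^i\Xi_i$, $k(t,s)=\sum_{i,j} t^is^jK_{ij}$ into the linear Volterra system $x(t)=\xi(t)+\int_0^t k(t,s)x(s)\,ds$. *)

(* Defs.v *)
From HB Require Import structures.
From mathcomp Require Import all_boot all_order all_algebra.
From mathcomp Require Import all_classical all_reals all_analysis.
Import Order.TTheory GRing.Theory Num.Theory.
Import numFieldNormedType.Exports.

Set Implicit Arguments.
Unset Strict Implicit.
Unset Printing Implicit Defensive.

Local Open Scope classical_set_scope.
Local Open Scope ring_scope.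

(* The canonical norm of the library on 'cV[R]_N is the sup norm, whereas an
   arbitrary norm on R^N is needed; hence norms as functions nu. *)
Record vector_norm (R : realType) (N : nat) (nu : 'cV[R]_N -> R) : Prop :=
  VectorNorm {
    vector_norm_eq0 : forall x, nu x = 0 -> x = 0 ;
    vector_normZ : forall (a : R) x, nu (a *: x) = `|a| * nu x ;
    vector_normD : forall x y, nu (x + y) <= nu x + nu y }.

(* The real-valued sup is 0 on unbounded sets; that does not occur here, since
   the set is bounded when nu is a norm (N is finite), and it contains 0. *)
Definition induced_norm (R : realType) (N : nat) (nu : 'cV[R]_N -> R)
    (A : 'M[R]_N) : R :=
  sup [set nu (A *m x) | x in [set x : 'cV[R]_N | nu x <= 1]].

(* Convergence is in the library topology of V; for V = 'cV[R]_N this is the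
   topology of every norm on R^N. *)
Definition convergence_radius (R : realType) (V : normedModType R)
    (a : nat -> V) : \bar R :=
  ereal_sup [set `|t|%:E | t in
    [set t : R | cvgn (series (fun n => t ^+ n *: a n))]].

Definition volterra_recursion (R : realType) (N : nat)
    (Xi : nat -> 'cV[R]_N) (K : nat -> nat -> 'M[R]_N)
    (X : nat -> 'cV[R]_N) : Prop :=
  forall n : nat,
    X n = Xi n + \sum_(l < n) \sum_(i < n - l)
                   (n - i)%:R^-1 *: (K i (n - i - l - 1)%N *m X l).

Definition Lseq (R : realType) (N : nat) (nu : 'cV[R]_N -> R)
    (K : nat -> nat -> 'M[R]_N) (n : nat) : R :=
  \sum_(i < n) induced_norm nu (K i (n - i - 1)%N).

(* Main.v *)
(** Since [1/(n-i) <= 1/(l+1)] in the recursion, the numbers [y_n = r^n |X_n|]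
    satisfy [y_n <= M0 + M * sum_(l < n) y_l / (l+1)], hence
    [y_n <= M0 * prod_(l < n) (1 + M / (l+1))] by comparison with the solution
    of the corresponding equality. Consecutive ratios of this majorant tend
    to 1, so the power series converges for all [|t| < r]; its radius is at
    least [r], and [r >= r / (1 + r * M)] because [0 = L_0 <= M]. *)
Require Import Defs.
From HB Require Import structures.
From mathcomp Require Import all_boot all_order all_algebra.
From mathcomp Require Import all_classical all_reals all_analysis.
Import Order.TTheory GRing.Theory Num.Theory.
Import numFieldNormedType.Exports.
Local Open Scope classical_set_scope.
Local Open Scope ring_scope.

(* Triggers the missing inference of [completeNormedModType] for matrices. *)
HB.instance Definition _ (R : realType) (m n : nat) :=
  Uniform_isComplete.Build 'M[R]_(m, n) cauchy_cvg.

(** * Equivalence of norms on R^N and the induced matrix norm *)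

Section VectorNorm.
Context {R : realType} {N : nat} {nu : 'cV[R]_N -> R}.
Hypothesis nu_norm : vector_norm nu.

Lemma vector_norm0 : nu 0 = 0.
Proof. by rewrite -(scale0r 0) (vector_normZ nu_norm) normr0 mul0r. Qed.

Lemma vector_norm_ge0 x : 0 <= nu x.
Proof.
have := vector_normD nu_norm x (- x).
rewrite subrr vector_norm0 -scaleN1r (vector_normZ nu_norm) normrN1 mul1r.
by rewrite -mulr2n pmulrn_lge0.
Qed.

Lemma vector_norm_sum (I : Type) (s : seq I) (P : pred I) (F : I -> 'cV[R]_N) :
  nu (\sum_(i <- s | P i) F i) <= \sum_(i <- s | P i) nu (F i).
Proof.
elim/big_ind2 : _ => [|x a y b xa yb|//]; first by rewrite vector_norm0.
by apply: le_trans (vector_normD nu_norm _ _) _; rewrite lerD.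
Qed.

(** Expand the product along the columns of [A]; each coordinate of [v] is at most its sup norm. The
    case [A = 1] gives continuity of [nu], the general case finiteness of the induced norm. Row
    vectors match the form of [EVT_min_rV]. *)
Lemma vector_norm_mulmx_le (A : 'M[R]_N) (v : 'rV[R]_N) :
  nu (A *m v^T) <= `|v| * \sum_i nu (col i A).
Proof.
have -> : A *m v^T = \sum_i v 0 i *: col i A.
  apply/colP => i; rewrite !mxE summxE; apply: eq_bigr => j _.
  by rewrite !mxE mulrC.
apply: le_trans (vector_norm_sum _ _ _ _) _.
rewrite mulr_sumr ler_sum// => i _; rewrite (vector_normZ nu_norm).
rewrite ler_wpM2r ?vector_norm_ge0//.
rewrite [leRHS]/Num.Def.normr /= mx_normrE; apply/bigmax_geP; right => /=.
by exists (0, i).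
Qed.

Lemma vector_norm_continuous : continuous (fun v : 'rV[R]_N => nu v^T).
Proof.
(* The summand 1 keeps this Lipschitz constant positive even when [N = 0], so that [e / C] makes
   sense. *)
pose C := 1 + \sum_i nu (col i 1%:M).
have C_gt0 : 0 < C by rewrite ltr_pwDl// sumr_ge0// => i _; exact: vector_norm_ge0.
have nuB u v : nu u^T - nu v^T <= C * `|u - v|.
  rewrite lerBlDr; have {1}-> : u^T = (u - v)^T + v^T.
    by rewrite linearB/= subrK.
  apply: le_trans (vector_normD nu_norm _ _) _; rewrite lerD2r.
  rewrite -{1}[(u - v)^T]mul1mx; apply: le_trans (vector_norm_mulmx_le _ _) _.
  by rewrite mulrC ler_wpM2r// /C lerDr.
move=> u; apply/(@cvgrPdist_le _ _ _ (nbhs u)) => e e_gt0.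
have : \forall v \near u, `|u - v| <= e / C.
  by apply: (@cvgr_dist_le _ _ _ (nbhs u) _ id); [exact: cvg_id|exact: divr_gt0].
apply: filterS => v; rewrite ler_pdivlMr// mulrC => uv.
by rewrite ler_norml lerNl opprB !(le_trans (nuB _ _))// distrC.
Qed.

Lemma trmx_norm_le (x : 'cV[R]_N) : `|x| <= `|x^T|.
Proof.
rewrite [leLHS]/Num.Def.normr /= mx_normrE; apply/bigmax_leP; split => //= -[i j] _ /=.
rewrite [leRHS]/Num.Def.normr /= mx_normrE; apply/bigmax_geP; right => /=.
by exists (j, i) => //=; rewrite mxE.
Qed.

(* Compactness of the unit sphere of the sup norm. *)
Lemma vector_norm_dominates :
  exists2 c : R, 0 < c & forall x : 'cV[R]_N, `|x^T| <= c * nu x.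
Proof.
pose S := [set v : 'rV[R]_N | `|v| = 1].
have normalized (x : 'cV[R]_N) : x != 0 -> S (`|x^T|^-1 *: x^T).
  move=> x0; rewrite /S/= normrZ normfV normr_id mulVf// normr_eq0.
  by apply: contra_neq x0 => /(congr1 trmx); rewrite trmxK trmx0.
(* The sphere is empty only for [N = 0]; then every [x] is 0 and any constant works. *)
have [S0|] := pselect (S !=set0); last first.
  move=> S0; exists 1 => // x; have [->|x0] := eqVneq x 0.
    by rewrite trmx0 normr0 vector_norm0 mulr0.
  by exfalso; apply: S0; eexists; exact: normalized x0.
have cS : compact S.
  apply: bounded_closed_compact.
    by exists 1; split => // e e1 v /= ->; exact: ltW.
  rewrite (_ : S = (fun v : 'rV[R]_N => `|v|) @^-1` [set 1])//.
  apply: preimage_closed; first by move=> v _; exact: norm_continuous.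
  exact: closed_eq.
have [v vS vmin] := EVT_min_rV S0 cS (continuous_subspaceT vector_norm_continuous).
have nuv_gt0 : 0 < nu v^T.
  rewrite lt_neqAle vector_norm_ge0 andbT eq_sym; apply: contraPneq vS.
  move=> /(vector_norm_eq0 nu_norm)/(congr1 trmx); rewrite trmxK trmx0 => ->.
  by rewrite inE /S/= normr0 => /esym/eqP; rewrite oner_eq0.
(* By homogeneity, the minimum of [nu] on the sphere bounds [nu x] from below by a multiple of the
   sup norm. *)
exists (nu v^T)^-1; first by rewrite invr_gt0.
move=> x; have [->|x0] := eqVneq x 0.
  by rewrite trmx0 normr0 vector_norm0 mulr0.
have /mem_set/vmin := normalized _ x0.
rewrite linearZ/= trmxK (vector_normZ nu_norm) normfV normr_id.
have xT_gt0 : 0 < `|x^T|.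
  by rewrite normr_gt0; apply: contra_neq x0 => /(congr1 trmx); rewrite trmxK trmx0.
by rewrite mulrC ler_pdivlMr// mulrC -ler_pdivlMr// mulrC.
Qed.

(** Guarantees that the [sup] in [induced_norm] is a true least upper bound and not the default
    value 0. *)
Lemma induced_norm_has_sup (A : 'M[R]_N) :
  has_sup [set nu (A *m x) | x in [set x : 'cV[R]_N | nu x <= 1]].
Proof.
split; first by exists (nu (A *m 0)), 0 => //=; rewrite vector_norm0.
have [c c_gt0 cP] := vector_norm_dominates.
exists (c * \sum_i nu (col i A)) => _ [x /= x1 <-].
rewrite -[x]trmxK; apply: le_trans (vector_norm_mulmx_le _ _) _.
rewrite ler_wpM2r ?sumr_ge0// => [i _|]; first exact: vector_norm_ge0.
by rewrite (le_trans (cP x))// ler_piMr// ltW.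
Qed.

Lemma induced_norm_mulmx (A : 'M[R]_N) (x : 'cV[R]_N) :
  nu (A *m x) <= induced_norm nu A * nu x.
Proof.
have [nux0|nux0] := eqVneq (nu x) 0.
  by rewrite (vector_norm_eq0 nu_norm nux0) mulmx0 vector_norm0 mulr0.
have nux_gt0 : 0 < nu x by rewrite lt_neqAle eq_sym nux0 vector_norm_ge0.
rewrite -ler_pdivrMr// mulrC.
have <- : nu (A *m ((nu x)^-1 *: x)) = (nu x)^-1 * nu (A *m x).
  by rewrite -scalemxAr (vector_normZ nu_norm) ger0_norm// invr_ge0 ltW.
apply: sup_upper_bound; first exact: induced_norm_has_sup.
exists ((nu x)^-1 *: x) => //=.
by rewrite (vector_normZ nu_norm) ger0_norm ?mulVf// invr_ge0 ltW.
Qed.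

Lemma volterra_recursion_norm_le (Xi : nat -> 'cV[R]_N)
    (K : nat -> nat -> 'M[R]_N) (X : nat -> 'cV[R]_N) (n : nat) :
  volterra_recursion Xi K X ->
  nu (X n) <= nu (Xi n) + \sum_(l < n) Lseq nu K (n - l) * (nu (X l) / l.+1%:R).
Proof.
move=> ->; apply: le_trans (vector_normD nu_norm _ _) _; rewrite lerD2l.
apply: le_trans (vector_norm_sum _ _ _ _) _; apply: ler_sum => l _.
apply: le_trans (vector_norm_sum _ _ _ _) _.
rewrite /Lseq mulr_suml; apply: ler_sum => i _.
(* Swapping the subtractions turns the second index of [K] into the one occurring in
   [Lseq nu K (n - l)]. *)
rewrite (vector_normZ nu_norm) normfV normr_nat (subnAC n i l).
rewrite mulrCA mulrC mulrA ler_pM ?invr_ge0 ?vector_norm_ge0//.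
  by rewrite mulrC induced_norm_mulmx.
have lt_l : (l < n - i)%N by rewrite ltn_subRL addnC -ltn_subRL.
by rewrite lef_pV2 ?posrE ?ltr0n ?ler_nat// (leq_ltn_trans _ lt_l).
Qed.

End VectorNorm.

(** * The scalar comparison sequence and its power series *)

Section ScalarMajorant.
Context {R : realType}.
Implicit Types (a b q s : R) (y u : nat -> R).

(** For [b >= 0] this is [a] times the generalized binomial coefficient of [n + b] over [n], the
    coefficient of [t^n] in [a (1 - t)^(-1-b)]. *)
Definition gronwall_majorant a b (n : nat) : R :=
  a * \prod_(l < n) (1 + b / l.+1%:R).

Lemma gronwall_majorantS a b n :
  gronwall_majorant a b n.+1 = gronwall_majorant a b n * (1 + b / n.+1%:R).
Proof. by rewrite /gronwall_majorant big_ord_recr/= mulrA. Qed.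

Lemma gronwall_majorant_ge0 a b n : 0 <= a -> 0 <= b ->
  0 <= gronwall_majorant a b n.
Proof.
move=> a0 b0; rewrite mulr_ge0// prodr_ge0// => l _.
by rewrite addr_ge0// divr_ge0.
Qed.

Lemma gronwall_majorantE a b n : gronwall_majorant a b n =
  a + b * \sum_(l < n) gronwall_majorant a b l / l.+1%:R.
Proof.
elim: n => [|n IHn]; first by rewrite /gronwall_majorant !big_ord0 mulr1 mulr0 addr0.
rewrite gronwall_majorantS big_ord_recr/= (mulrDr b) addrA -IHn.
by rewrite mulrDr mulr1 mulrCA.
Qed.

(** Strong induction: as [b >= 0], the right-hand side is monotone in the earlier terms, and the
    majorant satisfies the recursion with equality. *)
Lemma discrete_gronwall a b y : 0 <= b ->
  (forall n, y n <= a + b * \sum_(l < n) y l / l.+1%:R) ->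
  forall n, y n <= gronwall_majorant a b n.
Proof.
move=> b0 yle; elim/ltn_ind => n IHn; rewrite (le_trans (yle n))//.
rewrite gronwall_majorantE lerD2l ler_wpM2l// ler_sum// => l _.
by rewrite ler_wpM2r// IHn.
Qed.

Lemma ratio_test u q (m : nat) : (forall n, 0 <= u n) -> 0 < q < 1 ->
  (forall n, (m <= n)%N -> u n.+1 <= q * u n) -> cvgn (series u).
Proof.
(* [C] dominates each [u k / q ^+ k] with [k <= m], so the geometric bound covers the initial terms
   and then propagates by the ratio hypothesis. *)
move=> u0 /andP[q0 q1] uq; pose C := \sum_(k < m.+1) u k / q ^+ k.
have uqn0 k : 0 <= u k / q ^+ k by rewrite divr_ge0// exprn_ge0// ltW.
have uC n : u n <= geometric C q n.
  have small k : (k <= m)%N -> u k <= C * q ^+ k.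
    move=> km; rewrite -ler_pdivrMr ?exprn_gt0//.
    rewrite /C (bigD1 (Ordinal (km : k < m.+1)%N))//= lerDl.
    by apply: sumr_ge0 => i _; exact: uqn0.
  have [/small//|/ltnW mn] := leqP n m; rewrite /geometric/=.
  rewrite -(subnKC mn); elim: (n - m)%N => [|k IHk]; first by rewrite addn0 small.
  rewrite addnS (le_trans (uq _ (leq_addr _ _)))// exprS mulrCA.
  by rewrite ler_pM2l.
apply: (series_le_cvg u0 _ uC) => [n|].
  exact: le_trans (u0 n) (uC n).
by apply: is_cvg_geometric_series; rewrite ger0_norm// ltW.
Qed.

Lemma gronwall_majorant_pseries_cvg a b s : 0 <= a -> 0 <= b -> 0 < s < 1 ->
  cvgn (series (fun n => gronwall_majorant a b n * s ^+ n)).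
Proof.
move=> a0 b0 /andP[s0 s1].
have [q /andP[sq q1]] : exists q, s < q < 1.
  by exists ((s + 1) / 2); rewrite !midf_lt.
(* This threshold solves [(1 + b / n.+1%:R) * s <= q] for [n]. *)
have [m mP] : exists m : nat, b / (q / s - 1) < m%:R.
  by exists (Num.truncn (b / (q / s - 1))).+1; exact: truncnS_gt.
have q0 := lt_trans s0 sq.
apply: (@ratio_test _ q m); rewrite ?q0//.
  by move=> n; rewrite mulr_ge0 ?gronwall_majorant_ge0// exprn_ge0// ltW.
move=> n mn; rewrite gronwall_majorantS exprSr mulrACA [leRHS]mulrC ler_wpM2l//.
  by rewrite mulr_ge0 ?gronwall_majorant_ge0// exprn_ge0// ltW.
rewrite -ler_pdivlMr// -lerBrDl ler_pdivrMr// -ler_pdivrMl.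
  rewrite mulrC (le_trans (ltW mP))// ler_nat.
  exact: leq_trans mn (leqnSn _).
by rewrite subr_gt0 ltr_pdivlMr// mul1r.
Qed.

End ScalarMajorant.

Theorem theorem3p2 (R : realType) (N : nat)
    (nu : 'cV[R]_N -> R) (nu_norm : vector_norm nu)
    (Xi : nat -> 'cV[R]_N) (K : nat -> nat -> 'M[R]_N)
    (X : nat -> 'cV[R]_N) (X_rec : volterra_recursion Xi K X)
    (r M0 M : R) (r_gt0 : 0 < r)
    (Xi_le : forall n : nat, nu (Xi n) <= M0 / r ^+ n)
    (L_le : forall n : nat, Lseq nu K n <= M / r ^+ n) :
  ((r / (1 + r * M))%:E <= convergence_radius X)%E.
Proof.
have M_ge0 : 0 <= M.
  by have := L_le 0; rewrite /Lseq big_ord0 expr0 divr1.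
have M0_ge0 : 0 <= M0.
  by have := Xi_le 0; rewrite expr0 divr1; apply/le_trans/vector_norm_ge0.
have X_le n : nu (X n) * r ^+ n <= gronwall_majorant M0 M n.
  apply: (discrete_gronwall _ _ (fun n => nu (X n) * r ^+ n)) => // {}n.
  apply: le_trans (ler_wpM2r (exprn_ge0 n (ltW r_gt0))
    (volterra_recursion_norm_le nu_norm _ _ _ n X_rec)) _.
  rewrite mulrDl lerD//; first by rewrite -ler_pdivlMr ?exprn_gt0.
  rewrite mulr_suml mulr_sumr; apply: ler_sum => l _.
  have := L_le (n - l)%N; rewrite ler_pdivlMr ?exprn_gt0// => Ll.
  (* One factor cancels the decay of [Lseq nu K (n - l)], the other weights [X l]. *)
  have rn : r ^+ n = r ^+ (n - l) * r ^+ l by rewrite -exprD subnK// ltnW.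
  rewrite rn mulrACA [nu _ / _ * _]mulrAC ler_wpM2r// mulr_ge0 ?invr_ge0//.
  by rewrite mulr_ge0 ?vector_norm_ge0// exprn_ge0// ltW.
have r_le : (r%:E <= convergence_radius X)%E.
  (* The maximum with [r / 2] keeps [t] positive when [e >= r]. *)
  apply/lee_subgt0Pr => e e_gt0; pose t := Num.max (r - e) (r / 2).
  have t_lt : t < r by rewrite gt_max ltrBlDr ltrDl e_gt0 ltr_pdivrMr// ltr_pMr// ltr1n.
  have t_gt0 : 0 < t by rewrite lt_max divr_gt0 ?orbT.
  apply: (@le_trans _ _ t%:E); first by rewrite lee_fin le_max lexx.
  apply: ereal_sup_ubound; exists t => /=; last by rewrite gtr0_norm.
  have [c c_gt0 cP] := vector_norm_dominates nu_norm.
  have tr : 0 < t / r < 1 by rewrite divr_gt0// ltr_pdivrMr// mul1r.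
  (* Absolute convergence in the sup norm suffices by completeness; passing from it to [nu] costs
     the factor [c]. *)
  apply: normed_cvg => /=.
  apply: (@series_le_cvg _ _
    (fun n => gronwall_majorant (c * M0) M n * (t / r) ^+ n)) => [n|n|n|].
  - exact: normr_ge0.
  - rewrite mulr_ge0 ?gronwall_majorant_ge0 ?mulr_ge0 ?(ltW c_gt0)//.
    by rewrite exprn_ge0// divr_ge0 ?ltW.
  - rewrite /= normrZ gtr0_norm ?exprn_gt0//.
    apply: le_trans (ler_wpM2l (exprn_ge0 n (ltW t_gt0))
      (le_trans (trmx_norm_le _) (cP (X n)))) _.
    rewrite /gronwall_majorant -!mulrA mulrCA ler_pM2l// mulrA expr_div_n.
    by rewrite [leRHS]mulrCA ler_pM2l ?exprn_gt0// ler_pdivlMr ?exprn_gt0//; exact: X_le.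
  - by apply: gronwall_majorant_pseries_cvg; rewrite ?mulr_ge0 ?(ltW c_gt0).
apply: le_trans r_le; rewrite lee_fin.
have D_ge1 : 1 <= 1 + r * M by rewrite lerDl mulr_ge0// ltW.
by rewrite ler_pdivrMr ?(lt_le_trans ltr01)// ler_peMr// ltW.
Qed.
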